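(* Let $\sigma$ be a fixed permutation. For $n\ge 1$ let $P(n)$ be the probability that the interval $[\sigma,\tau]$ has a non-trivial disconnected subinterval, where $\tau$ is a permutation chosen uniformly at random among all permutations of length $n$. Then $$\lim_{n\to\infty} P(n) = 1 .$$ Consequently, almost all intervals $[\sigma,\tau]$ are not shellable; that is, the probability that $\sigma\le\tau$ and $[\sigma,\tau]$ is not shellable, for $\tau$ chosen uniformly at random among permutations of length $n$, tends to $1$ as $n\to\infty$.
   Context: The permutation pattern poset $\mathcal{P}$ is the set of all permutations of $\{1,\dots,n\}$ for all $n>0$ (written as words), ordered by pattern containment: $\sigma\le\tau$ if $\tau$ has a subsequence whose letters appear in the same relative order of size as those of $\sigma$. Write $|\pi|$ for the length of $\pi$. The closed interval is $[\sigma,\tau]=\{\pi : \sigma\le\pi\le\tau\}$ and the open interval is $(\sigma,\tau)=\{\pi:\sigma<\pi<\tau\}$; the rank of $[\sigma,\tau]$ (with $\sigma\le\tau$) is $|\tau|-|\sigma|$. A subinterval of $[\sigma,\tau]$ is an interval $[\sigma',\tau']$ with $\sigma\le\sigma'\le\tau'\le\tau$. Topological properties of an interval $[\sigma,\tau]$ (disconnected, shellable) mean those of the order complex $\Delta(\sigma,\tau)$ of the open interval $(\sigma,\tau)$, i.e. the simplicial complex whose faces are the chains of $(\sigma,\tau)$. In particular $[\sigma,\tau]$, or $(\sigma,\tau)$, is disconnected if $(\sigma,\tau)$ is the disjoint union of two nonempty subsets such that no element of one is comparable to an element of the other. A disconnected subinterval $[\sigma',\tau']$ is called non-trivial if its rank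 is at least $3$. *)

(* Defs.v *)
From HB Require Import structures.
From mathcomp Require Import all_boot all_order all_fingroup all_algebra finmap.
From mathcomp Require Import all_classical all_reals all_analysis.

Set Implicit Arguments.
Unset Strict Implicit.
Unset Printing Implicit Defensive.

Import Order.TTheory GRing.Theory Num.Theory.
Import numFieldNormedType.Exports.

Local Open Scope nat_scope.

(* The poset of all permutations of positive length under pattern containment;
   a permutation of length n.+1 is an element of 'S_n.+1, with letters
   0, ..., n instead of 1, ..., n + 1. *)
Definition pattern : Type := {n : nat & 'S_n.+1}.

HB.instance Definition _ := Choice.copy pattern {n : nat & 'S_n.+1}.

Definition pattern_of n (p : 'S_n.+1) : pattern := Tagged (fun n => 'S_n.+1) p.

Definition plength (p : pattern) : nat := (tag p).+1.

(* f lists, from left to right, the positions in q of an occurrence of p. *)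
Definition occurrence k n (p : 'S_k) (q : 'S_n) (f : {ffun 'I_k -> 'I_n}) :=
  [forall i : 'I_k, forall j : 'I_k, (i < j) ==> (f i < f j)] &&
  [forall i : 'I_k, forall j : 'I_k, (p i < p j) == (q (f i) < q (f j))].

Definition contains (p q : pattern) : bool :=
  [exists f : {ffun _ -> _}, occurrence (tagged p) (tagged q) f].

Lemma occurrenceP k n (p : 'S_k) (q : 'S_n) (f : {ffun 'I_k -> 'I_n}) :
  reflect ((forall i j : 'I_k, i < j -> f i < f j) /\
           (forall i j : 'I_k, (p i < p j) = (q (f i) < q (f j))))
          (occurrence p q f).
Proof.
apply: (iffP andP) => -[h1 h2]; split.
- by move=> i j; move/forallP/(_ i)/forallP/(_ j)/implyP: h1; apply.
- by move=> i j; move/forallP/(_ i)/forallP/(_ j)/eqP: h2.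
- by apply/forallP => i; apply/forallP => j; apply/implyP/h1.
- by apply/forallP => i; apply/forallP => j; apply/eqP/h2.
Qed.

Lemma contains_refl : reflexive contains.
Proof.
move=> p; apply/existsP; exists [ffun i => i].
by apply/occurrenceP; split=> i j; rewrite !ffunE.
Qed.

Lemma contains_trans : transitive contains.
Proof.
move=> q p r /existsP[f /occurrenceP[f1 f2]] /existsP[g /occurrenceP[g1 g2]].
apply/existsP; exists [ffun i => g (f i)]; apply/occurrenceP.
by split=> i j; rewrite !ffunE ?f2 ?g2// => /f1/g1.
Qed.

Lemma incr_ord_ge k n (f : 'I_k -> 'I_n) :
  (forall i j : 'I_k, i < j -> f i < f j) -> forall i : 'I_k, i <= f i.
Proof.
move=> fi [i ltik]; elim: i ltik => //= i IH ltik.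
exact: leq_ltn_trans (IH (ltnW ltik)) (fi (Ordinal (ltnW ltik)) (Ordinal ltik) _).
Qed.

Lemma incr_ord_leq k n (f : 'I_k.+1 -> 'I_n.+1) :
  (forall i j : 'I_k.+1, i < j -> f i < f j) -> k <= n.
Proof.
move=> fi; have := incr_ord_ge fi ord_max => /leq_trans; apply.
by rewrite -ltnS ltn_ord.
Qed.

Lemma incr_ord_id n (f : 'I_n -> 'I_n) :
  (forall i j : 'I_n, i < j -> f i < f j) -> f =1 id.
Proof.
move=> fi; pose g i := rev_ord (f (rev_ord i)).
have gi (i j : 'I_n) : i < j -> g i < g j.
  move=> ltij; have ltf : f (rev_ord j) < f (rev_ord i).
    by apply: fi => /=; apply: ltn_sub2l => //; apply: leq_ltn_trans (ltn_ord j).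
  by apply: ltn_sub2l => //; apply: leq_ltn_trans (ltn_ord (f (rev_ord i))).
move=> i; apply/val_inj/eqP; rewrite /= eqn_leq (incr_ord_ge fi) andbT.
have := incr_ord_ge gi (rev_ord i); rewrite /g rev_ordK /= => le_fi.
by rewrite -ltnS -(leq_sub2lE _ (ltn_ord (f i))).
Qed.

Lemma perm_order_inj n (p q : 'S_n) :
  (forall i j, (p i < p j) = (q i < q j)) -> p = q.
Proof.
move=> pq; apply/permP => i.
have := @incr_ord_id n (fun i => q ((p^-1)%g i)) _ (p i).
by rewrite /= permK => -> // a b; rewrite -pq !permKV.
Qed.

Lemma contains_anti : antisymmetric contains.
Proof.
move=> [k p] [n q] /andP[] /existsP[/= f /occurrenceP[f1 f2]].
move=> /existsP[/= g /occurrenceP[g1 _]].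
have ekn : k = n.
  by apply/eqP; rewrite eqn_leq (incr_ord_leq f1) (incr_ord_leq g1).
case: n / ekn q f {g g1} f1 f2 => q f f1 f2; congr Tagged.
by apply: perm_order_inj => i j; rewrite f2 !(incr_ord_id f1).
Qed.

Fact pattern_display : Order.disp_t. Proof. exact: (Order.Disp tt tt). Qed.

HB.instance Definition _ := Order.Le_isPOrder.Build pattern_display pattern
  contains_refl contains_anti contains_trans.

Section OrderComplex.
Local Open Scope order_scope.
Local Open Scope classical_set_scope.
Context {d : Order.disp_t} {T : porderType d}.

Definition interval_disconnected (a b : T) : Prop :=
  exists A B : set T,
    [/\ A `|` B = [set x | a < x < b], A `&` B = set0, A !=set0, B !=set0 &
        forall x y, A x -> B y -> x >< y].

Definition order_complex (a b : T) : set {fset T} :=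
  [set C | (forall x, x \in C -> a < x < b) /\ {in C &, forall x y, x >=< y}].

End OrderComplex.

Section Shellability.
Local Open Scope fset_scope.
Local Open Scope ring_scope.
Context {T : choiceType}.
Implicit Types (D : set {fset T}) (F G : {fset T}).

Definition facet D F : Prop := D F /\ forall G, D G -> F `<=` G -> G = F.

(* The dimension is an integer since the empty face has dimension -1. *)
Definition face_dim F : int := #|` F|%:Z - 1.

Definition pure_of_dim D (m : int) : Prop := forall F, facet D F -> face_dim F = m.

(* The common part of each facet with the earlier ones has codimension 1.
   D need not be pure, though order complexes of pattern intervals are, since
   the pattern poset is graded by length. *)
Definition shelling D (s : seq {fset T}) : Prop :=
  [/\ uniq s, forall F, F \in s <-> facet D F &
      forall k, (0 < k < size s)%N ->
        let Fk := nth fset0 s k in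
        pure_of_dim
          [set G | (G `<=` Fk)%fset /\
               exists2 j, (j < k)%N & (G `<=` nth fset0 s j)%fset]%classic
          (face_dim Fk - 1)].

Definition shellable D : Prop := exists s, shelling D s.

End Shellability.

Section Intervals.
Local Open Scope order_scope.

Definition has_nontrivial_disconnected_subinterval (p q : pattern) : Prop :=
  exists p' q' : pattern,
    [/\ p <= p', p' <= q', q' <= q, (3 <= plength q' - plength p')%N &
        interval_disconnected p' q'].

End Intervals.

(* Probability of the event E for a uniform random permutation of length n,
   where n >= 1 (so that n.-1.+1 is n); the value at n = 0 is irrelevant. *)
Definition perm_prob (R : realType) (n : nat) (E : pattern -> Prop) : R :=
  (#|[pred t : 'S_n.-1.+1 | `[< E (pattern_of t) >]]|%:R
    / #|{: 'S_n.-1.+1}|%:R)%R.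

(* Main.v *)
Require Import Defs.
From HB Require Import structures.
From mathcomp Require Import all_boot all_order all_fingroup all_algebra finmap.
From mathcomp Require Import all_classical all_reals all_analysis.
From mathcomp Require Import zify.

Set Implicit Arguments.
Unset Strict Implicit.
Unset Printing Implicit Defensive.

Import Order.TTheory GRing.Theory Num.Theory.
Import numFieldNormedType.Exports.

(** The two limits rest on one pattern that forces a disconnection.  Let [p] be
a permutation of length [M >= 3] that contains [sigma] and starts with its
largest letter; adding two such initial letters to [sigma] gives one.  In the
direct sum [p (+) p] every letter of the lower half is smaller than, and to the
left of, every letter of the upper half.  Wherever the first letter of an
occurrence of [p] lands, the other letters are to its right and smaller, so the
occurrence stays in that half, and it fills the half because of its length
([occurs_dsum_covers]).  Hence an element strictly between [p] and [p (+) p]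
has an occurrence that fills the lower half or one that fills the upper half,
and elements of different kinds are incomparable: an inclusion would push one
letter beyond the filled half ([covers_not_le]).  Both kinds exist, namely
[p (+) 1] and [1 (+) p], so the interval from [p] to [p (+) p], of rank [M], is
disconnected ([dsum_interval_disconnected]).

Every [tau] that contains [r = p (+) p] therefore has a non-trivial disconnected
subinterval above [sigma], and a uniform random [tau] contains the fixed pattern
[r], of length [k], with probability tending to 1.  Indeed the patterns of the
first [n] and of the last [k] letters of a random permutation of length [n + k]
are independent and uniform ([card_lpat_rpat]), so lengthening by [k] letters
multiplies the probability of avoiding [r] by at most [1 - 1/k!]
([avoid_freq_step]), and that probability decays geometrically.

A non-trivial disconnected subinterval obstructs shellability
([nontrivial_disconnected_not_shellable]).  Its order complex is the link of a
chain [C], and every facet of this link has at least two elements, all in the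
same one of the two parts.  In a shelling, consider the first facet above [C]
that belongs to the part whose facets come later.  It shares [C] with an
earlier facet, so by purity it shares with some earlier facet a codimension 1
face containing [C]; that face has an element outside [C], so the earlier facet
belongs to the same part, which contradicts the choice
([not_shellable_of_split_link]). *)

(** * Occurrences of patterns *)

Section Patterns.
Local Open Scope nat_scope.

Definition occurs k n (p : 'S_k) (q : 'S_n) (f : 'I_k -> 'I_n) : Prop :=
  (forall i j : 'I_k, i < j -> f i < f j) /\
  (forall i j, (p i < p j) = (q (f i) < q (f j))).

Lemma pattern_leP (p q : pattern) :
  reflect (exists f, occurs (tagged p) (tagged q) f) (p <= q)%O.
Proof.
apply: (iffP existsP) => [[f /occurrenceP fP]|[f [f1 f2]]]; first by exists f.
by exists [ffun i => f i]; apply/occurrenceP; split=> i j; rewrite !ffunE //; apply: f1.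
Qed.

Lemma occurs_le k n (p : 'S_k.+1) (q : 'S_n.+1) f :
  occurs p q f -> (pattern_of p <= pattern_of q)%O.
Proof. by move=> pqf; apply/pattern_leP; exists f. Qed.

Lemma occurs_comp k m n (p : 'S_k) (q : 'S_m) (r : 'S_n) f g :
  occurs p q f -> occurs q r g -> occurs p r (g \o f).
Proof.
move=> [f1 f2] [g1 g2]; split=> i j /=; first by move=> /f1/g1.
by rewrite f2 g2.
Qed.

Lemma increasing_inj k n (f : 'I_k -> 'I_n) :
  (forall i j : 'I_k, i < j -> f i < f j) -> injective f.
Proof.
move=> fi i j eq_f; apply/val_inj; case: (ltngtP i j) => // /fi.
  by rewrite eq_f ltnn.
by rewrite eq_f ltnn.
Qed.

Lemma plength_le (p q : pattern) : (p <= q)%O -> plength p <= plength q.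
Proof.
by move=> /pattern_leP[f [f1 _]]; exact: (incr_ord_leq f1).
Qed.

Lemma plength_lt (p q : pattern) : (p < q)%O -> plength p < plength q.
Proof.
rewrite lt_neqAle => /andP[neq le_pq].
rewrite ltn_neqAle plength_le // andbT; apply: contra neq => /eqP[e].
case: p q e le_pq => [k p] [n q] /= e; case: n / e q => q.
move=> /pattern_leP[f [f1 f2]]; apply/eqP; congr Tagged.
by apply: perm_order_inj => i j; rewrite [LHS]f2 /= !(incr_ord_id f1).
Qed.

(** * Standardization *)

Section Standardization.
Context {k n : nat} {f : 'I_k -> 'I_n} (f_inj : injective f) (t : 'S_n).

Let below i : pred 'I_k := [pred j | t (f j) < t (f i)].

Lemma card_below_lt i j : (#|below i| < #|below j|) = (t (f i) < t (f j)).
Proof.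
have lt_card a b : t (f a) < t (f b) -> #|below a| < #|below b|.
  move=> lt_ab; apply/proper_card/fintype.properP; split; last by exists a; rewrite !inE ?ltnn.
  by apply/fintype.subsetP => c; rewrite !inE => /ltn_trans; apply.
apply/idP/idP => [lt_c|]; last exact: lt_card.
case: (ltngtP (t (f i)) (t (f j))) lt_c => // [/lt_card lt_c1 lt_c2|].
  by have := ltn_trans lt_c1 lt_c2; rewrite ltnn.
by move=> /val_inj/perm_inj/f_inj ->; rewrite ltnn.
Qed.

Lemma card_below_ord i : #|below i| < k.
Proof.
rewrite -[X in _ < X]card_ord; apply/proper_card/fintype.properP.
by split; [exact: subset_predT | exists i; rewrite // !inE ltnn].
Qed.

Lemma rank_inj : injective (fun i => Ordinal (card_below_ord i)).
Proof.
move=> i j [] eq_c; apply/f_inj/(@perm_inj _ t)/val_inj.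
by case: (ltngtP (t (f i)) (t (f j))) => //; rewrite -card_below_lt eq_c ltnn.
Qed.

Definition std : 'S_k := perm rank_inj.

Lemma std_lt i j : (std i < std j) = (t (f i) < t (f j)).
Proof. by rewrite !permE card_below_lt. Qed.

End Standardization.

Lemma std_occurs k n (f : 'I_k -> 'I_n) (f_inj : injective f) (t : 'S_n) :
  (forall i j : 'I_k, i < j -> f i < f j) -> occurs (std f_inj t) t f.
Proof. by move=> fi; split=> // i j; rewrite std_lt. Qed.

(** Deleting a letter of [q] outside an occurrence of [p] leaves a pattern that
still contains [p]: this is why the pattern poset is graded by length. *)
Lemma pattern_interpolate (p q : pattern) : (p <= q)%O ->
  plength p < plength q ->
  exists r : pattern, [/\ (p <= r)%O, (r <= q)%O & (plength r).+1 = plength q].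
Proof.
case: p q => [k p] [n q] /pattern_leP[/= f pqf]; have [f1 f2] := pqf.
rewrite /plength /= ltnS => lt_kn.
have [m fm] : exists m, m \notin codom f.
  apply/existsP; rewrite -negb_forall; apply/negP => /forallP f_onto.
  have : #|'I_n.+1| <= #|codom f| by apply/subset_leq_card/fintype.subsetP => x _.
  by rewrite card_codom ?card_ord; [rewrite leqNgt ltnS lt_kn|exact: increasing_inj].
case: n => [//|n] in q f f1 f2 pqf lt_kn m fm *.
have lift_lt (i j : 'I_n.+1) : (lift m i < lift m j) = (i < j) by rewrite /= !ltnNge leq_bump2.
have mono_lift (i j : 'I_n.+1) : i < j -> lift m i < lift m j by rewrite lift_lt.
pose r := std (@lift_inj _ m) q.
have rP : occurs r q (lift m) by apply: std_occurs.
exists (pattern_of r); split => //; last exact: (occurs_le rP).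
(* [f] avoids the deleted position [m], so it factors through [lift m]. *)
have /fin_all_exists[g gP] i : exists j, f i = lift m j.
  have : m != f i by apply: contra fm => /eqP ->; apply: codom_f.
  by move=> /unlift_some[j ->]; exists j.
apply: (@occurs_le _ _ _ _ g); split=> i j.
  by move=> /f1; rewrite !gP lift_lt.
by rewrite f2 std_lt !gP.
Qed.

Lemma pattern_dense (p q : pattern) : (p <= q)%O ->
  (plength p).+1 < plength q -> exists2 r : pattern, (p < r)%O & (r < q)%O.
Proof.
move=> le_pq lt2; have [r [le_pr le_rq lr]] := pattern_interpolate le_pq (ltnW lt2).
exists r; rewrite lt_neqAle ?le_pr ?le_rq andbT.
  by apply: contraTneq lt2 => ->; rewrite lr ltnn.
by apply/eqP => e; have := lr; rewrite e; lia.
Qed.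

(** * Direct sums *)

Definition dsum_fun a b (p : 'S_a) (q : 'S_b) (i : 'I_(a + b)) : 'I_(a + b) :=
  match fintype.split i with inl j => lshift b (p j) | inr j => rshift a (q j) end.

Lemma dsum_funE a b (p : 'S_a) (q : 'S_b) :
  (forall i, dsum_fun p q (lshift b i) = lshift b (p i)) *
  (forall i, dsum_fun p q (rshift a i) = rshift a (q i)).
Proof.
rewrite /dsum_fun; split=> i.
  by rewrite (_ : lshift b i = unsplit (inl i)) // unsplitK.
by rewrite (_ : rshift a i = unsplit (inr i)) // unsplitK.
Qed.

Lemma dsum_fun_inj a b (p : 'S_a) (q : 'S_b) : injective (dsum_fun p q).
Proof.
apply: (can_inj (g := dsum_fun p^-1%g q^-1%g)) => i.
by case: (split_ordP i) => j ->; rewrite !dsum_funE permK.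
Qed.

Definition dsum a b (p : 'S_a) (q : 'S_b) : 'S_(a + b) := perm (@dsum_fun_inj a b p q).

Lemma dsumE a b (p : 'S_a) (q : 'S_b) :
  (forall i, dsum p q (lshift b i) = lshift b (p i)) *
  (forall i, dsum p q (rshift a i) = rshift a (q i)).
Proof. by split=> i; rewrite permE dsum_funE. Qed.

Lemma dsum_ltl a b (p : 'S_a) (q : 'S_b) i : (dsum p q i < a) = (i < a).
Proof.
by case: (split_ordP i) => j ->; rewrite dsumE /= ?ltn_ord // !ltnNge !leq_addr.
Qed.

Lemma dsum_occurs_l a b (p : 'S_a) (q : 'S_b) : occurs p (dsum p q) (lshift b).
Proof. by split=> // i j; rewrite !dsumE. Qed.

Lemma dsum_occurs_r a b (p : 'S_a) (q : 'S_b) : occurs q (dsum p q) (@rshift a b).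
Proof. by split=> i j; rewrite ?dsumE /= ltn_add2l. Qed.

End Patterns.

(** * Shellings and disconnected links *)

Section Shelling.
Local Open Scope fset_scope.
Context {T : choiceType}.
Implicit Types (D : set {fset T}) (F G C : {fset T}).

Lemma facet_above D N : (forall F, D F -> (#|` F| <= N)%N) ->
  forall F, D F -> exists2 G, facet D G & F `<=` G.
Proof.
move=> DN F; have [m] := ubnP (N - #|` F|); elim: m F => // m IH F ltm DF.
case: (pselect (facet D F)) => [facF|nfacF]; first by exists F.
have [G [DG FG neG]] : exists G, [/\ D G, F `<=` G & G <> F].
  apply: contrapT => noG; apply: nfacF; split=> // G DG FG.
  by apply: contrapT => neG; apply: noG; exists G.
have ltFG : (#|` F| < #|` G|)%N.
  by apply: fproper_ltn_card; rewrite fproperEneq FG andbT; apply/eqP => /esym.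
have [] := IH G; rewrite ?(leq_trans _ ltm) //.
  rewrite ltnS in ltm; apply: leq_trans ltm; apply: ltn_sub2l => //.
  exact: leq_trans ltFG (DN _ DG).
by move=> H facH GH; exists H => //; apply: fsubset_trans GH.
Qed.

(** A shellable complex of positive dimension is connected, and links inherit
shellability.  The proof below compares only facets that contain [C], so that the
shelling induced on the link need not be constructed. *)
Lemma not_shellable_of_split_link D C (A B : set T) :
  (forall x, A x -> B x -> False) ->
  (forall F, facet D F -> C `<=` F ->
    (2 <= #|` F `\` C|)%N /\
    ({in F `\` C, forall x, A x} \/ {in F `\` C, forall x, B x})) ->
  (exists F, [/\ facet D F, C `<=` F & {in F `\` C, forall x, A x}]) ->
  (exists F, [/\ facet D F, C `<=` F & {in F `\` C, forall x, B x}]) ->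
  ~ shellable D.
Proof.
move=> AB CF exA exB [s [_ sP purP]].
pose over (Q : set T) F := `[< C `<=` F /\ {in F `\` C, forall x, Q x} >].
have has_over Q : (exists F, [/\ facet D F, C `<=` F & {in F `\` C, forall x, Q x}]) ->
    has (over Q) s.
  by move=> [F [/sP sF CsF FQ]]; apply/hasP; exists F => //; apply/asboolP.
(* [Fk] will be the first facet above [C] with its new elements in [B]; up to
   exchanging [A] and [B], some facet with its new elements in [A] precedes it. *)
wlog ltAB : A B AB CF exA exB / (find (over A) s <= find (over B) s)%N.
  move=> W; case: (leqP (find (over A) s) (find (over B) s)) => [|/ltnW]; first exact: W.
  apply: W => // [x Bx Ax|F facF CsF]; first exact: AB Ax Bx.
  by have [c [|]] := CF F facF CsF; split=> //; [right|left].
have hA := has_over _ exA; have hB := has_over _ exB.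
have kB := hB; rewrite has_find in kB.
set k := find (over B) s in ltAB kB; pose Fk := nth fset0 s k.
have /asboolP[CFk FkB] : over B Fk by apply: nth_find.
have facFk : facet D Fk by apply/sP/mem_nth.
have [cFk _] := CF _ facFk CFk.
have /asboolP[CFj FjA] : over A (nth fset0 s (find (over A) s)) by apply: nth_find.
have ltk : (find (over A) s < k)%N.
  rewrite ltn_neqAle ltAB andbT; apply/eqP => e; rewrite e -/Fk in FjA.
  have /fset0Pn[x xF] : Fk `\` C != fset0 by rewrite -cardfs_gt0 ltnW.
  exact: AB (FjA x xF) (FkB x xF).
have := purP k; rewrite (leq_ltn_trans _ ltk) //= kB -/Fk => /(_ isT).
set E := (X in pure_of_dim X _) => pureE.
(* [C] is a common face of [Fk] and an earlier facet, so it lies in a maximal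
   common face [H], which purity forces to have codimension 1 in [Fk]. *)
have [F||H facH CH] := @facet_above E #|` Fk| _ C.
- by move=> [/fsubset_leq_card].
- by split=> //; exists (find (over A) s).
have [[HFk [j ltj HFj]] _] := facH.
have cH : (#|` Fk| = #|` H|.+1)%N.
  by have := pureE _ facH; rewrite /face_dim => /(@addIr _ _ _)/eqP; lia.
(* [Fk] has two elements outside [C], so [H] still has one. *)
have [x xH xC] : exists2 x, x \in H & x \notin C.
  have /fset0Pn[x] : H `\` C != fset0.
    rewrite -cardfs_gt0 cardfsDS // subn_gt0 -ltnS -cH.
    by move: cFk; rewrite cardfsDS // ltn_subRL addn1.
  by rewrite inE => /andP[xC xH]; exists x.
have facFj : facet D (nth fset0 s j) by apply/sP/mem_nth/(ltn_trans ltj).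
have xFj : x \in nth fset0 s j `\` C by rewrite inE xC (fsubsetP HFj).
have CsFj : C `<=` nth fset0 s j by apply: fsubset_trans HFj.
have Bx : B x by apply: FkB; rewrite inE xC (fsubsetP HFk).
have [_ [FA|FB]] := CF _ facFj CsFj; first exact: AB (FA x xFj) Bx.
have := before_find fset0 ltj; rewrite /over; case: asboolP => // -[].
by split.
Qed.

End Shelling.

(** * Disconnected subintervals obstruct shellability *)

Section PatternShelling.
Local Open Scope fset_scope.

(** The members of a chain have distinct lengths, all smaller than that of [q].
*)
Lemma pattern_chain_card (p q : pattern) F :
  order_complex p q F -> (#|` F| <= plength q)%N.
Proof.
move=> [F_pq F_chain]; rewrite -(size_iota 0 (plength q)) -(size_map plength).
apply: uniq_leq_size.
  rewrite map_inj_in_uniq ?fset_uniq // => x y xF yF eq_l.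
  case/orP: (F_chain _ _ xF yF); rewrite le_eqVlt => /predU1P[//|/plength_lt];
    by rewrite eq_l ltnn.
move=> _ /mapP[x xF ->]; rewrite mem_iota /= add0n.
by have /andP[_ /plength_lt] := F_pq _ xF.
Qed.

Lemma order_complexU1 (d : Order.disp_t) (T : porderType d) (a b x : T) F :
  order_complex a b F -> (a < x < b)%O -> (forall y, y \in F -> (x >=< y)%O) ->
  order_complex a b (x |` F).
Proof.
move=> [F_ab F_chain] x_ab xF; split=> [y|y z].
  by rewrite !inE => /predU1P[->|/F_ab].
rewrite !inE => /predU1P[->|yF] /predU1P[->|zF].
- exact: comparablexx.
- exact: xF.
- by rewrite comparable_sym; apply: xF.
- exact: F_chain.
Qed.

Lemma facet_mem (d : Order.disp_t) (T : porderType d) (a b x : T) F :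
  facet (order_complex a b) F -> (a < x < b)%O ->
  (forall y, y \in F -> (x >=< y)%O) -> x \in F.
Proof.
move=> [DF Fmax] x_ab xF.
have /Fmax <- := order_complexU1 DF x_ab xF; first by rewrite !inE eqxx.
exact: fsubsetU1.
Qed.

(** The open subinterval from [p'] to [q'] is realized as the link of the part
[C] of a facet [X] that lies outside it; taking [X] through [p'] and [q'] makes
every larger facet agree with [X] outside the subinterval.  Rank at least 3
makes the facets of the link have at least two elements. *)
Lemma nontrivial_disconnected_not_shellable (p q : pattern) :
  has_nontrivial_disconnected_subinterval p q ->
  ~ shellable (order_complex p q).
Proof.
move=> [p' [q' [le_pp' le_p'q' le_q'q rk [A [B [ABE AB0 A0 B0 ABincomp]]]]]].
have AB_between x : A x \/ B x <-> (p' < x < q')%O.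
  have -> : (A x \/ B x) = (A `|` B)%classic x by [].
  by rewrite ABE.
have AB_comp x y : A x -> B y -> ~ (x >=< y)%O.
  by move=> Ax By; apply/negP; exact: ABincomp.
have between x : (p' < x < q')%O -> (p < x < q)%O.
  move=> /andP[p'x xq'].
  by rewrite (le_lt_trans le_pp' p'x) (lt_le_trans xq' le_q'q).
set D := order_complex p q.
have [a Aa] := A0; have [b Bb] := B0.
have /andP[p'a aq'] : (p' < a < q')%O by apply/AB_between; left.
have lt_p'q' := lt_trans p'a aq'.
pose E := [fset x in [:: p'; a; q'] | (p < x < q)%O].
have DE : D E.
  split=> [x|x y]; rewrite !inE /=; first by case/andP.
  move=> /andP[xE _] /andP[yE _]; rewrite /Order.comparable; move: xE yE.
  have [[pa aq] pq] := (ltW p'a, ltW aq', ltW lt_p'q').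
  by move=> /or3P[]/eqP-> /or3P[]/eqP->; rewrite ?lexx ?pa ?aq ?pq ?orbT.
have [X [DX Xmax] EX] := facet_above (@pattern_chain_card p q) DE.
pose C := [fset x in X | (x <= p')%O || (q' <= x)%O].
have CX : C `<=` X by apply/fsubsetP => x; rewrite !inE => /andP[].
have p'C : p' = p \/ p' \in C.
  have [->|neq] := eqVneq p' p; [by left|right].
  have p'X : p' \in X.
    apply: (fsubsetP EX); rewrite !inE eqxx /= lt_neqAle eq_sym neq le_pp' /=.
    exact: lt_le_trans lt_p'q' le_q'q.
  by rewrite !inE p'X lexx.
have q'C : q' = q \/ q' \in C.
  have [->|neq] := eqVneq q' q; [by left|right].
  have q'X : q' \in X.
    apply: (fsubsetP EX); rewrite !inE eqxx !orbT /= [(q' < q)%O]lt_neqAle neq le_q'q !andbT.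
    exact: le_lt_trans le_pp' lt_p'q'.
  by rewrite !inE q'X lexx orbT.
have inside x : x \in X -> x \notin C -> (p' < x < q')%O.
  move=> xX; rewrite !inE xX /= negb_or => /andP[nxp' nq'x].
  have [X_pq X_chain] := DX; have /andP[px xq] := X_pq x xX; apply/andP; split.
    case: p'C => [->//|/(fsubsetP CX) p'X].
    by move: nxp'; have /comparable_leP[|] := X_chain _ _ xX p'X.
  case: q'C => [->//|/(fsubsetP CX) q'X].
  by move: nq'x; have /comparable_leP[|] := X_chain _ _ q'X xX.
have outside F : facet D F -> C `<=` F -> forall x, x \in F `\` C -> (p' < x < q')%O.
  move=> [[F_pq F_chain] _] CF x; rewrite inE => /andP[xC xF].
  have /andP[px xq] := F_pq x xF.
  (* An element of [F] below [p'] or above [q'] that is comparable with [X]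
     belongs to [X] by maximality, hence to [C]. *)
  have mem_C : (forall y, y \in X -> y \notin C -> (x >=< y)%O) ->
      (x <= p')%O || (q' <= x)%O -> False.
    move=> x_comp x_out; case/negP: xC; rewrite !inE x_out andbT.
    apply: facet_mem (conj DX Xmax) (F_pq x xF) _ => y yX.
    have [yC|] := boolP (y \in C); last exact: x_comp.
    exact: F_chain (fsubsetP CF _ yC).
  apply/andP; split.
    case: p'C => [->//|p'C].
    have := F_chain _ _ xF (fsubsetP CF _ p'C) => /comparable_leP[le_xp'|//].
    case: mem_C; last by rewrite le_xp'.
    move=> y yX /(inside y yX)/andP[p'y _].
    by rewrite le_comparable // (le_trans le_xp' (ltW p'y)).
  case: q'C => [->//|q'C].
  have := F_chain _ _ (fsubsetP CF _ q'C) xF => /comparable_leP[le_q'x|//].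
  case: mem_C; last by rewrite le_q'x orbT.
  move=> y yX /(inside y yX)/andP[_ yq'].
  by rewrite ge_comparable // (le_trans (ltW yq') le_q'x).
have comp_C x : (p' < x < q')%O -> forall y, y \in C -> (x >=< y)%O.
  move=> /andP[p'x xq'] y; rewrite !inE => /andP[_ /orP[yp'|q'y]].
    by rewrite ge_comparable // (le_trans yp' (ltW p'x)).
  by rewrite le_comparable // (le_trans (ltW xq') q'y).
have extend x : (p' < x < q')%O -> exists F, [/\ facet D F, C `<=` F & x \in F `\` C].
  move=> x_in; have DC : D C.
    have [X_pq X_chain] := DX; split=> [y /(fsubsetP CX)/X_pq //|y z yC zC].
    by apply: X_chain; apply: (fsubsetP CX).
  have DxC := order_complexU1 DC (between x x_in) (comp_C x x_in).
  have [F facF] := facet_above (@pattern_chain_card p q) DxC.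
  rewrite fsubUset fsub1set => /andP[xF CF]; exists F; split=> //.
  rewrite inE xF andbT !inE negb_and negb_or; have /andP[p'x xq'] := x_in.
  by rewrite (lt_geF p'x) (lt_geF xq') orbT.
have split_link F : facet D F -> C `<=` F ->
   {in F `\` C, forall x, A x} \/ {in F `\` C, forall x, B x}.
  move=> facF CF; have [[_ F_chain] _] := facF.
  have [|nFA] := pselect {in F `\` C, forall x, A x}; [by left|right=> y yFC].
  have /AB_between[Ay|//] := outside F facF CF y yFC.
  case: nFA => x xFC; have /AB_between[//|Bx] := outside F facF CF x xFC.
  case: (AB_comp _ _ Ay Bx); apply: F_chain.
    by move: yFC; rewrite inE => /andP[].
  by move: xFC; rewrite inE => /andP[].
have large F : facet D F -> C `<=` F -> (2 <= #|` F `\` C|)%N.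
  move=> facF CF; rewrite leqNgt; apply/negP => small.
  (* If at most one element lies outside [C], the rank leaves room for another
     one, which contradicts the maximality of [F]. *)
  suff [y y_in y_comp] : exists2 y, (p' < y < q')%O &
      forall x, x \in F `\` C -> (y >=< x)%O /\ y <> x.
    have yF : y \in F.
      apply: facet_mem facF (between y y_in) _ => x xF.
      have [xC|xC] := boolP (x \in C); first exact: comp_C.
      by have [] := y_comp x; rewrite // inE xC.
    have yC : y \notin C.
      rewrite !inE negb_and negb_or; have /andP[p'y yq'] := y_in.
      by rewrite (lt_geF p'y) (lt_geF yq') orbT.
    by have [] := y_comp y; rewrite // inE yC.
  have [FC0|/fset0Pn[x xFC]] := eqVneq (F `\` C) fset0.
    by exists a; rewrite ?p'a // FC0 => x; rewrite inE.
  have FCx z : z \in F `\` C -> z = x.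
    move=> zFC; apply/eqP; have : [fset x] == F `\` C.
      by rewrite eqEfcard fsub1set xFC cardfs1 -ltnS.
    by move=> /eqP FC1; move: zFC; rewrite -FC1 inE.
  have /andP[p'x xq'] := outside F facF CF x xFC.
  have [lt2|] := ltnP (plength p').+1 (plength x).
    have [y p'y yx] := pattern_dense (ltW p'x) lt2.
    exists y => [|z /FCx ->]; first by rewrite p'y (lt_trans yx xq').
    by rewrite lt_comparable //; split=> // e; rewrite e ltxx in yx.
  move=> le1; have lt2 : ((plength x).+1 < plength q')%N by move: rk le1; clear; lia.
  have [y xy yq'] := pattern_dense (ltW xq') lt2.
  exists y => [|z /FCx ->]; first by rewrite yq' (lt_trans p'x xy).
  by rewrite gt_comparable //; split=> // e; rewrite e ltxx in xy.
apply: (@not_shellable_of_split_link _ D C A B).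
- by move=> x Ax Bx; have : (A `&` B)%classic x by []; rewrite AB0.
- by move=> F facF CF; split; [exact: large|exact: split_link].
- have [|F [facF CF aF]] := extend a; first by apply/AB_between; left.
  have [|FB] := split_link F facF CF; first by exists F.
  by have := AB_comp _ _ Aa (FB _ aF); rewrite comparablexx.
- have [|F [facF CF bF]] := extend b; first by apply/AB_between; right.
  have [FA|] := split_link F facF CF; last by exists F.
  by have := AB_comp _ _ (FA _ bF) Bb; rewrite comparablexx.
Qed.

End PatternShelling.

(** * The interval from a permutation to its double *)

Section Disconnected.
Local Open Scope nat_scope.

Lemma increasing_lt k n (f : 'I_k -> 'I_n) :
  (forall i j : 'I_k, i < j -> f i < f j) -> forall i j : 'I_k, (f i < f j) = (i < j).
Proof.
move=> fi i j; apply/idP/idP; last exact: fi.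
by case: (ltngtP i j) => // [/fi|/val_inj ->]; [case: ltngtP | rewrite ltnn].
Qed.

Lemma occurs_factor k m n (p : 'S_k) (q : 'S_m) (r : 'S_n) f g e :
  occurs p r f -> occurs q r g -> (forall i, f i = g (e i)) -> occurs p q e.
Proof.
move=> [f1 f2] [g1 g2] fge; split=> i j; last by rewrite f2 g2 !fge.
by move=> /f1; rewrite !fge increasing_lt.
Qed.

Lemma pattern_lt (p q : pattern) : (p <= q)%O -> plength p < plength q -> (p < q)%O.
Proof.
by move=> le_pq lt_l; rewrite lt_neqAle le_pq andbT; apply: contraTneq lt_l => ->; rewrite ltnn.
Qed.

Context {m : nat} (p : 'S_m.+1).
Hypothesis p_max : p ord0 = ord_max.

(* The length is displayed as a successor so that [pp] is also a pattern. *)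
Let pp : 'S_(m + m.+1).+1 := dsum p p.

(** Both halves are treated at once: [true] stands for the lower one. *)
Definition half (b : bool) : 'I_m.+1 -> 'I_(m.+1 + m.+1) :=
  if b then @lshift m.+1 m.+1 else @rshift m.+1 m.+1.

Lemma half_occurs b : occurs p pp (half b).
Proof. by case: b; [exact: (dsum_occurs_l p p) | exact: (dsum_occurs_r p p)]. Qed.

Lemma half_cases b (i : 'I_(m.+1 + m.+1)) :
  (exists j, i = half b j) \/ (exists j, i = half (~~ b) j).
Proof.
by case: (split_ordP i) b => j -> []; [left|right|right|left]; exists j.
Qed.

Lemma half_true_lt b j : (half b j < m.+1) = b.
Proof. by case: b => /=; rewrite ?ltn_ord // ltnNge leq_addr. Qed.

Definition covers n (b : bool) (g : 'I_n -> 'I_(m.+1 + m.+1)) :=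
  forall j, exists i, g i = half b j.

(** Since [p] starts with its largest letter, the half that receives the first
letter receives all of them; being as long as [p], it is filled. *)
Lemma occurs_dsum_covers f : occurs p pp f -> exists b, covers b f.
Proof.
move=> pf; have [f1 f2] := pf; pose b := (f ord0 < m.+1).
have same i : (f i < m.+1) = b.
  apply/idP/idP => [fi|f0].
    have [i0|i_n0] := eqVneq i ord0; first by rewrite /b -i0.
    by apply: ltn_trans fi; apply: f1; rewrite lt0n.
  have pp_lt j : (pp j < m.+1) = (j < m.+1) := dsum_ltl p p j.
  rewrite -pp_lt; apply: leq_ltn_trans (_ : pp (f ord0) < m.+1); last by rewrite pp_lt.
  by rewrite leqNgt -f2 p_max -leqNgt -ltnS.
have /fin_all_exists[e eP] i : exists j, f i = half b j.
  have [//|[j fij]] := half_cases b (f i).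
  by have := same i; rewrite fij half_true_lt; case: (b).
have e_inj : injective e.
  by move=> i j eij; apply: (increasing_inj f1); rewrite !eP eij.
by exists b => j; have /codomP[i ->] := injF_onto e_inj j; exists i.
Qed.

Lemma covers_both n (g : 'I_n -> 'I_(m.+1 + m.+1)) b :
  covers b g -> covers (~~ b) g -> m.+1 + m.+1 <= n.
Proof.
move=> gb gnb; rewrite -[X in X <= _]card_ord -[X in _ <= X]card_ord.
have /fin_all_exists[e eP] i : exists j, g j = i.
  by have [[j ->]|[j ->]] := half_cases b i.
by apply: (@leq_card _ _ e) => i j eij; rewrite -(eP i) -(eP j) eij.
Qed.

(** Suppose that [x <= y].  Composing, the copy of [p] in [x] is sent by [h] onto
one of the two halves.  If it is half [b], then [h] fills both halves and [y] is
too long.  Otherwise it fills the other half, but [x] has a further letter,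
beyond its copy of [p] on the side of that half, and no room is left for it. *)
Lemma covers_not_le b (x y : pattern) g h :
  occurs (tagged x) pp g -> covers b g -> m.+1 < plength x ->
  occurs (tagged y) pp h -> covers (~~ b) h -> plength y < m.+1 + m.+1 ->
  ~ (x <= y)%O.
Proof.
move=> xg gb lt_mx yh hnb lt_ym /pattern_leP[f xyf].
have /fin_all_exists[e eP] := gb.
have pxe : occurs p (tagged x) e.
  by apply: occurs_factor (half_occurs b) xg _ => i; rewrite eP.
have xhf := occurs_comp xyf yh.
have [c hc] := occurs_dsum_covers (occurs_comp pxe xhf).
have [i0 [j0 gi0]] : exists i0, exists j0, g i0 = half (~~ b) j0.
  apply: contrapT => no_i0; move: lt_mx; rewrite ltnNge => /negP; apply.
  have /fin_all_exists[u uP] i : exists j, g i = half b j.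
    by have [//|[j gij]] := half_cases b (g i); case: no_i0; exists i, j.
  rewrite -[X in X <= _]card_ord -[X in _ <= X]card_ord.
  apply: (@leq_card _ _ u) => i j eij; apply: (increasing_inj xg.1).
  by rewrite !uP eij.
have [ecb|ecb] := eqVneq c b.
  have hb : covers b h.
    by move=> j; have [i /= hi] := hc j; exists (f (e i)); rewrite hi ecb.
  by have := covers_both hb hnb; rewrite leqNgt lt_ym.
have {ecb} cb : c = ~~ b by case: b c ecb {hc gb hnb eP gi0} => [] [].
move: hc; rewrite {}cb {hnb}; case: b => /= in gb eP gi0 * => hc.
- have [i /= hi] := hc ord_max.
  have : e i < i0 by rewrite -(increasing_lt xg.1) eP gi0 /= ltn_addr.
  by move=> /xhf.1 /=; rewrite hi /= => lt_hf; have := ltn_ord (h (f i0)); lia.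
- have [i /= hi] := hc ord0.
  have : i0 < e i by rewrite -(increasing_lt xg.1) eP gi0 /= ltn_addr.
  by move=> /xhf.1 /=; rewrite hi.
Qed.

(** The witnesses are [p (+) 1] for the lower half and [1 (+) p] for the upper
one, read off at [m.+2] consecutive positions of [p (+) p]. *)
Lemma half_extension b : 0 < m ->
  exists x : pattern, [/\ (pattern_of p < x < pattern_of pp)%O &
    exists2 g, occurs (tagged x) pp g & covers b g].
Proof.
move=> m_gt0; pose s := if b then 0 else m.
have bound (i : 'I_m.+2) : i + s < m.+1 + m.+1.
  by have := ltn_ord i; rewrite /s; case: (b); lia.
pose g i := Ordinal (bound i).
have g_lt (i j : 'I_m.+2) : i < j -> g i < g j by rewrite /= ltn_add2r.
pose x := std (increasing_inj g_lt) pp.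
have xg : occurs x pp g by apply: std_occurs.
have /fin_all_exists[e eP] j : exists i, g i = half b j.
  have i_lt : j + ~~ b < m.+2 by have := ltn_ord j; case: (b); lia.
  exists (Ordinal i_lt); apply/val_inj; rewrite /= /s /half.
  by case: (b) => /=; lia.
have pxe : occurs p x e by apply: occurs_factor (half_occurs b) xg _ => i; rewrite eP.
exists (pattern_of x); split; last by exists g => // j; exists (e j).
apply/andP; split; apply: pattern_lt.
- exact: occurs_le pxe.
- by rewrite /plength /=.
- exact: occurs_le xg.
- by rewrite /plength /=; lia.
Qed.

Lemma dsum_interval_disconnected : 0 < m -> interval_disconnected (pattern_of p) (pattern_of pp).
Proof.
move=> m_gt0.
pose S b := [set x : pattern | (pattern_of p < x < pattern_of pp)%O /\
  exists2 g, occurs (tagged x) pp g & covers b g]%classic.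
have S_not_le b x y : S b x -> S (~~ b) y -> ~ (x <= y)%O.
  move=> [/andP[ax _] [g xg gb]] [/andP[_ yc] [h yh hnb]].
  exact: covers_not_le xg gb (plength_lt ax) yh hnb (plength_lt yc).
exists (S true), (S false); split.
- apply/seteqP; split=> x /=; first by move=> [[]|[]].
  move=> x_in; have /andP[/ltW/pattern_leP[f pf] /ltW/pattern_leP[g xg]] := x_in.
  have [b gfb] := occurs_dsum_covers (occurs_comp pf xg).
  have gb : covers b g by move=> j; have [i <-] := gfb j; exists (f i).
  by case: b gb {gfb} => gb; [left|right]; split=> //; exists g.
- apply/seteqP; split=> // x [xT xF]; exact: (S_not_le true x x xT xF (lexx x)).
- by have [x []] := half_extension true m_gt0; exists x; split.
- by have [x []] := half_extension false m_gt0; exists x; split.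
- move=> x y xT yF; apply/negP => /orP[].
    exact: (S_not_le true).
  exact: (S_not_le false).
Qed.

End Disconnected.

Section Inflation.
Local Open Scope nat_scope.

Lemma lift_max_occurs n (s : 'S_n) : occurs s (lift_perm ord0 ord_max s) (lift ord0).
Proof.
split=> i j; first by rewrite !lift0.
by rewrite !lift_perm_lift !lift_max.
Qed.

(** Two new initial maxima are added because the rank of the interval is the
length of [p], which has to be at least 3 even when [s] has length 1. *)
Lemma exists_pattern_forcing_disconnected k (s : 'S_k.+1) :
  exists K, exists r : 'S_K.+1, forall q : pattern, (pattern_of r <= q)%O ->
    has_nontrivial_disconnected_subinterval (pattern_of s) q.
Proof.
pose p := lift_perm ord0 ord_max (lift_perm ord0 ord_max s).
exists (k.+2 + k.+3), (dsum p p) => q le_q.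
exists (pattern_of p), (pattern_of (n := k.+2 + k.+3) (dsum p p)); split=> //.
- exact: occurs_le (occurs_comp (lift_max_occurs s) (lift_max_occurs _)).
- exact: (@occurs_le _ _ _ _ (@lshift _ _)) (dsum_occurs_l p p).
- by rewrite /plength /= -addSn addKn.
- by apply: dsum_interval_disconnected; rewrite ?lift_perm_id.
Qed.

End Inflation.

(** * Counting permutations that avoid a pattern *)

Section Counting.
Local Open Scope nat_scope.

Definition avoiders k (r : 'S_k) n : pred 'S_n :=
  [pred t : 'S_n | ~~ [exists f : {ffun 'I_k -> 'I_n}, occurrence r t f]].

#[global] Arguments avoiders {k} r n.

Lemma avoidersPn k (r : 'S_k) n (t : 'S_n) :
  reflect (exists f, occurs r t f) (t \notin avoiders r n).
Proof.
rewrite inE negbK; apply: (iffP existsP) => [[f /occurrenceP fP]|[f [f1 f2]]]; first by exists f.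
by exists [ffun i => f i]; apply/occurrenceP; split=> i j; rewrite !ffunE //; apply: f1.
Qed.

Lemma avoiders_occurs k (r : 'S_k) m n (s : 'S_m) (t : 'S_n) f :
  occurs s t f -> t \in avoiders r n -> s \in avoiders r m.
Proof.
move=> st; apply: contraLR => /avoidersPn[g rs]; apply/avoidersPn.
by exists (f \o g); apply: occurs_comp rs st.
Qed.

Lemma lshift_lt a b (i j : 'I_a) : i < j -> lshift b i < lshift b j.
Proof. by []. Qed.

Lemma rshift_lt a b (i j : 'I_b) : i < j -> rshift a i < rshift a j.
Proof. by rewrite /= ltn_add2l. Qed.

Definition lpat a b (t : 'S_(a + b)) : 'S_a := std (increasing_inj (@lshift_lt a b)) t.
Definition rpat a b (t : 'S_(a + b)) : 'S_b := std (increasing_inj (@rshift_lt a b)) t.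

Lemma lpat_dsum_mul a b x y (t : 'S_(a + b)) : lpat (dsum x y * t)%g = (x * lpat t)%g.
Proof. by apply: perm_order_inj => i j; rewrite std_lt !permM std_lt !dsumE. Qed.

Lemma rpat_dsum_mul a b x y (t : 'S_(a + b)) : rpat (dsum x y * t)%g = (y * rpat t)%g.
Proof. by apply: perm_order_inj => i j; rewrite std_lt !permM std_lt !dsumE. Qed.

(** Independence and uniformity of the two patterns.  Left multiplication by
[dsum x y] permutes ['S_(a + b)] and translates the pair of patterns by [(x, y)];
averaging over all translations makes each permutation [t] count [#|P| * #|Q|]
times. *)
Lemma card_lpat_rpat a b (P : pred 'S_a) (Q : pred 'S_b) :
  #|[pred t : 'S_(a + b) | P (lpat t) && Q (rpat t)]| * (a`! * b`!)
  = (a + b)`! * (#|P| * #|Q|).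
Proof.
have card_mulr n (w : 'S_n) (T : pred 'S_n) : #|[pred x | T (x * w)%g]| = #|T|.
  rewrite -!sum1_card [RHS](reindex_inj (mulIg w)).
  by apply: eq_bigl => x.
transitivity (\sum_(xy : 'S_a * 'S_b) \sum_(t : 'S_(a + b))
   (P (xy.1 * lpat t)%g && Q (xy.2 * rpat t)%g : nat)).
  transitivity (\sum_(xy : 'S_a * 'S_b)
      #|[pred t : 'S_(a + b) | P (lpat t) && Q (rpat t)]|).
    by rewrite sum_nat_const card_prod !card_Sn mulnC.
  apply: eq_bigr => -[x y] _ /=.
  rewrite -sum1_card big_mkcond (reindex_inj (mulgI (dsum x y))) /=.
  by apply: eq_bigr => t _; rewrite inE lpat_dsum_mul rpat_dsum_mul; case: ifP.
rewrite exchange_big /= -(card_Sn (a + b)) -sum_nat_const; apply: eq_bigr => t _.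
rewrite -(card_mulr _ (lpat t) P) -(card_mulr _ (rpat t) Q).
rewrite -cardX -sum1_card [RHS]big_mkcond; apply: eq_bigr => -[x y] _.
by rewrite inE /=; case: ifP.
Qed.

(** If [t] avoids [r], then its first [n] letters avoid [r] and its last [k]
letters do not form [r]. *)
Lemma card_avoiders_le k (r : 'S_k) n :
  #|avoiders r (n + k)| * (n`! * k`!) <= (n + k)`! * (#|avoiders r n| * (k`!).-1).
Proof.
have := card_lpat_rpat (avoiders r n) (predC1 r); rewrite cardC1 card_Sn => <-.
rewrite leq_mul2r; apply/orP; right; apply/subset_leq_card/fintype.subsetP => t tA.
rewrite inE; apply/andP; split.
  exact: avoiders_occurs (std_occurs _ t (@lshift_lt n k)) tA.
apply: contraTneq tA => <-; apply/avoidersPn; exists (@rshift n k).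
exact: (std_occurs _ t (@rshift_lt n k)).
Qed.

End Counting.

(** * Convergence of the probabilities *)

Section Limit.
Context {R : realType}.
Local Open Scope classical_set_scope.
Local Open Scope ring_scope.

Definition avoid_freq k (r : 'S_k) (n : nat) : R := #|avoiders r n|%:R / n`!%:R.

Lemma fact_natr_gt0 n : 0 < n`!%:R :> R.
Proof. by rewrite ltr0n fact_gt0. Qed.

Lemma avoid_freq_le1 k (r : 'S_k) n : avoid_freq r n <= 1.
Proof.
by rewrite ler_pdivrMr ?fact_natr_gt0 // mul1r ler_nat -card_Sn max_card.
Qed.

Lemma avoid_freq_step k (r : 'S_k) n :
  avoid_freq r (n + k) <= avoid_freq r n * (1 - k`!%:R^-1).
Proof.
have [[an ak] ank] := (fact_natr_gt0 n, fact_natr_gt0 k, fact_natr_gt0 (n + k)).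
have := card_avoiders_le r n; rewrite -(ler_nat R) !natrM -subn1 natrB ?fact_gt0 // => le_c.
rewrite ler_pdivrMr // /avoid_freq.
rewrite -(ler_pM2r (mulr_gt0 an ak)); apply: le_trans le_c _.
rewrite -{1}[#|_|%:R](divfK (lt0r_neq0 an)).
have -> : k`!%:R - 1 = (1 - k`!%:R^-1) * k`!%:R :> R.
  by rewrite mulrBl mul1r mulVf ?lt0r_neq0.
by rewrite (mulrACA _ n`!%:R) [leLHS]mulrA [X in X * _ <= _]mulrC.
Qed.

Lemma avoid_freq_cvg0 k (r : 'S_k.+1) : avoid_freq r n @[n --> \oo] --> (0 : R).
Proof.
pose z : R := 1 - k.+1`!%:R^-1.
have z_ge0 : 0 <= z by rewrite subr_ge0 invf_le1 ?fact_natr_gt0 // ler1n fact_gt0.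
have z_lt1 : z < 1 by rewrite gtrBl invr_gt0 fact_natr_gt0.
have freq_le c d : avoid_freq r (d + c * k.+1) <= z ^+ c.
  elim: c => [|c IH]; first by rewrite addn0 avoid_freq_le1.
  rewrite mulSnr addnA exprSr; apply: le_trans (avoid_freq_step _ _) _.
  exact: ler_wpM2r.
have freq_bound n : 0 <= avoid_freq r n <= z ^+ (n %/ k.+1)%N.
  rewrite divr_ge0 ?ler0n //= {1}(divn_eq n k.+1) addnC; exact: freq_le.
have div_oo : (n %/ k.+1)%N @[n --> \oo] --> \oo.
  apply/cvgnyPge => A; exists (A * k.+1)%N => // n /= le_n.
  by rewrite leq_divRL.
apply: (squeeze_cvgr (f := cst 0) (h := fun n => z ^+ (n %/ k.+1)%N)).
- by near=> n; exact: freq_bound.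
- exact: cvg_cst.
- by apply: (cvg_comp _ _ div_oo); apply: cvg_expr; rewrite ger0_norm.
Unshelve. all: by end_near.
Qed.

Lemma perm_prob_cvg1 k (r : 'S_k.+1) (E : pattern -> Prop) :
  (forall q, (pattern_of r <= q)%O -> E q) ->
  perm_prob R n E @[n --> \oo] --> (1 : R).
Proof.
move=> rE.
have bound n : (0 < n)%N -> 1 - avoid_freq r n <= perm_prob R n E <= 1.
  case: n => // n _; rewrite /perm_prob /avoid_freq -card_Sn /=.
  set M := #|{: 'S_n.+1}|; have M_gt0 : 0 < M%:R :> R by rewrite /M card_Sn fact_natr_gt0.
  rewrite ler_pdivrMr // ler_pdivlMr // mul1r mulrBl divfK ?gt_eqF // mul1r.
  rewrite ler_nat max_card andbT lerBlDl -natrD ler_nat /M -(cardC (avoiders r n.+1)) leq_add2l.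
  apply/subset_leq_card/fintype.subsetP => t /avoidersPn[f rf].
  by rewrite inE; apply: rE; exact: occurs_le rf.
apply: (squeeze_cvgr (f := fun n => 1 - avoid_freq r n) (h := cst 1)).
- by exists 1%N => // n /= /bound.
- rewrite -[X in _ --> X]subr0; apply: cvgB; [exact: cvg_cst|exact: avoid_freq_cvg0].
- exact: cvg_cst.
Qed.

End Limit.

Local Open Scope classical_set_scope.
Local Open Scope ring_scope.

Theorem theorem4p3 (R : realType) (sigma : pattern) :
  (perm_prob R n
     (fun tau => has_nontrivial_disconnected_subinterval sigma tau)
     @[n --> \oo] --> (1 : R)) /\
  (perm_prob R n
     (fun tau => (sigma <= tau)%O /\ ~ shellable (order_complex sigma tau))
     @[n --> \oo] --> (1 : R)).
Proof.
case: sigma => k s; have [K [r rE]] := exists_pattern_forcing_disconnected s.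
split; apply: (@perm_prob_cvg1 _ _ r) => // q /rE disc_q; split.
  by have [p' [q' [le1 le2 le3 _ _]]] := disc_q; rewrite (le_trans le1) // (le_trans le2).
exact: nontrivial_disconnected_not_shellable.
Qed.
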